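(* There are no maximal trees with countable levels in $\mathcal{P}(\omega)/\mathrm{fin}$. That is, no maximal tree $\mathcal{T}$ in $\mathcal{P}(\omega)/\mathrm{fin}$ has the property that every level $\mathrm{Lev}_\alpha(\mathcal{T})$ is (at most) countable.
   Context: A partial order $(\mathcal{T},\leq)$ is a tree if it has a largest element $\mathbf{1}$ and for every $t\in\mathcal{T}$ the set of predecessors $\mathrm{pred}_{\mathcal{T}}(t)=\{s\in\mathcal{T}: s>t\}$ is well-ordered by the reverse of $\leq$ (trees grow downwards). For an ordinal $\alpha$, the $\alpha$-th level is $\mathrm{Lev}_\alpha(\mathcal{T})=\{t\in\mathcal{T}:\mathrm{pred}_{\mathcal{T}}(t)\text{ has order type }\alpha\}$. If $(\mathbb{P},\leq)$ is a partial order with largest element $\mathbf{1}$, a tree in $\mathbb{P}$ (subtree of $\mathbb{P}$) is a subset $\mathcal{T}\subseteq\mathbb{P}$ with $\mathbf{1}\in\mathcal{T}$ such that $\mathcal{T}$ with the induced order is a tree. Incomparable elements of $\mathcal{T}$ may be compatible in $\mathbb{P}$. $\mathcal{T}$ end-extends $\mathcal{S}$ if $\mathcal{S}\subseteq\mathcal{T}$ and $\mathrm{pred}_{\mathcal{T}}(s)=\mathrm{pred}_{\mathcal{S}}(s)$ for every $s\in\mathcal{S}$. A tree in $\mathbb{P}$ is maximal if it has no proper end-extension that is a tree in $\mathbb{P}$. A tree in $\mathcal{P}(\omega)/\mathrm{fin}$ means a tree in the partial order of nonzero elements of $\mathcal{P}(\omega)/\mathrm{fin}$ (equivalence classes $[A]$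 of infinite sets $A\subseteq\omega$ modulo finite sets), ordered by $[A]\leq[B]$ iff $A\subseteq^* B$, i.e. iff $A\setminus B$ is finite; its largest element is $[\omega]$. *)

(* Defs.v *)
From HB Require Import structures.
From mathcomp Require Import all_boot all_order.
From mathcomp Require Import boolp classical_sets cardinality wochoice.

Set Implicit Arguments.
Unset Strict Implicit.
Unset Printing Implicit Defensive.

Import Order.TTheory.

Local Open Scope classical_set_scope.
Local Open Scope order_scope.
Local Open Scope quotient_scope.

Section Trees.
Context {d : Order.disp_t}.

Definition tree_pred {P : porderType d} (T : set P) (t : P) : set P :=
  [set s | T s /\ t < s].

(* [T] is a tree for the order induced by [P]. *)
Definition is_tree {P : porderType d} (T : set P) : Prop :=
  (exists2 m, T m & forall t, T t -> t <= m) /\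
  forall t, T t -> wo_chain >=%O (mem (tree_pred T t)).

(* An ordinal is given by a well-ordered type [alpha] of that order type
   (possibly empty). As trees grow downwards, the isomorphism between [alpha]
   and the predecessors of [t] reverses the order of [P]. *)
Definition tree_level {P : porderType d} (T : set P)
    {d' : Order.disp_t} (alpha : orderType d') : set P :=
  [set t | T t /\ exists2 f : alpha -> P,
     {mono f : a b /~ a <= b} & range f = tree_pred T t].

Definition countable_levels {P : porderType d} (T : set P) : Prop :=
  forall (d' : Order.disp_t) (alpha : orderType d'),
    well_order (<=%O : rel alpha) -> countable (tree_level T alpha).

Definition tree_in {P : tPOrderType d} (T : set P) : Prop :=
  T \top /\ is_tree T.

Definition end_extends {P : porderType d} (T S : set P) : Prop :=
  S `<=` T /\ forall s, S s -> tree_pred T s = tree_pred S s.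

Definition maximal_tree {P : tPOrderType d} (T : set P) : Prop :=
  tree_in T /\ ~ exists T', [/\ tree_in T', end_extends T' T & T' <> T].

End Trees.

Definition infset := {A : set nat | `[< infinite_set A >]}.

Definition eqfin (A B : infset) : bool := `[< finite_set (val A `+` val B) >].

Definition lefin (A B : infset) : bool := `[< finite_set (val A `\` val B) >].

Lemma lefin_refl : reflexive lefin.
Proof. by move=> A; apply/asboolP; rewrite setDv; apply: finite_set0. Qed.

Lemma lefin_trans : transitive lefin.
Proof.
move=> B A C /asboolP AB /asboolP BC; apply/asboolP.
apply: (@sub_finite_set _ _ ((val A `\` val B) `|` (val B `\` val C))).
  move=> x [Ax nCx]; have [Bx|nBx] := pselect (val B x); first by right.
  by left.
by rewrite finite_setU.
Qed.

Lemma eqfinE A B : eqfin A B = lefin A B && lefin B A.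
Proof.
apply/asboolP/andP; rewrite /setY finite_setU => -[AB BA].
  by split; apply/asboolP.
by split; apply/asboolP.
Qed.

Lemma eqfin_refl : reflexive eqfin.
Proof. by move=> A; rewrite eqfinE lefin_refl. Qed.

Lemma eqfin_sym : symmetric eqfin.
Proof. by move=> A B; rewrite !eqfinE andbC. Qed.

Lemma eqfin_trans : transitive eqfin.
Proof.
move=> B A C; rewrite !eqfinE => /andP[AB BA] /andP[BC CB].
by rewrite (lefin_trans AB BC) (lefin_trans CB BA).
Qed.

Canonical eqfin_equiv := EquivRel eqfin eqfin_refl eqfin_sym eqfin_trans.

(* The nonzero elements of P(omega)/fin. *)
Definition Pfin := {eq_quot eqfin}.

HB.instance Definition _ := Choice.on Pfin.
HB.instance Definition _ := EqQuotient.on Pfin.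

Definition Pfin_le (X Y : Pfin) : bool := lefin (repr X) (repr Y).

Lemma Pfin_eqE (A B : infset) : (\pi_Pfin A == \pi_Pfin B) = eqfin A B.
Proof. exact: pi_eq_quot. Qed.

Lemma repr_eqfin (A : infset) : eqfin (repr (\pi_Pfin A)) A.
Proof. by rewrite -Pfin_eqE reprK. Qed.

Lemma Pfin_leE (A B : infset) :
  Pfin_le (\pi_Pfin A) (\pi_Pfin B) = lefin A B.
Proof.
have := repr_eqfin A; have := repr_eqfin B.
rewrite !eqfinE => /andP[rB Br] /andP[rA Ar]; apply/idP/idP => AB.
  exact: lefin_trans (lefin_trans Ar AB) rB.
exact: lefin_trans (lefin_trans rA AB) Br.
Qed.

Lemma Pfin_le_refl : reflexive Pfin_le.
Proof. by move=> X; apply: lefin_refl. Qed.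

Lemma Pfin_le_anti : antisymmetric Pfin_le.
Proof.
by move=> X Y; rewrite /Pfin_le -eqfinE -Pfin_eqE !reprK => /eqP.
Qed.

Lemma Pfin_le_trans : transitive Pfin_le.
Proof. by move=> Y X Z; apply: lefin_trans. Qed.

Fact Pfin_display : Order.disp_t. Proof. exact: Order.Disp tt tt. Qed.

HB.instance Definition _ := Order.Le_isPOrder.Build Pfin_display Pfin
  Pfin_le_refl Pfin_le_anti Pfin_le_trans.

Lemma infsetT_subproof : `[< infinite_set [set: nat] >].
Proof. by apply/asboolP; apply: infinite_nat. Qed.

Definition infsetT : infset := Sub [set: nat] infsetT_subproof.

Lemma Pfin_lex1 (X : Pfin) : X <= \pi_Pfin infsetT.
Proof.
rewrite -[X]reprK [_ <= _]Pfin_leE; apply/asboolP.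
by rewrite /= setDT; apply: finite_set0.
Qed.

HB.instance Definition _ := Order.hasTop.Build Pfin_display Pfin Pfin_lex1.

(* Main.v *)
(* Suppose T is a maximal tree with countable levels, and let L be its first
   level below the top. If X is below no element of L, split X into two disjoint
   sets of this kind: nothing in T but the top is above either of them, so, T
   having no end-extension, some element of T is below X. Being below no element
   of the countable set L survives a fusion of countably many steps. Hence for
   some X0 of this kind and a single s0 in L, each X below X0 of this kind has
   below it an element of T below s0. So T is dense in the sigma-closed order Q
   of all X below X0 and s0 that are below no other element of L. But a tree T
   with countable levels is not dense in a sigma-closed atomless order Q: below
   a suitable p in Q, every condition is compatible with some element of each
   level that T reaches below p. A binary subtree of T below p has its levels
   bounded by that of a single v below p, and its continuum many branches demand
   pairwise distinct elements on the level of v. *)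
From HB Require Import structures.
Require Import Defs.
From mathcomp Require Import all_boot all_order classical_sets.
From mathcomp Require Import boolp cardinality wochoice.

Set Implicit Arguments.
Unset Strict Implicit.
Unset Printing Implicit Defensive.

Import Order.TTheory.

Local Open Scope classical_set_scope.
Local Open Scope order_scope.

(** * Dependent choice and enumeration of countable sets *)

Lemma dependent_choice_inv (A : Type) (I : set A) (R : nat -> A -> A -> Prop) a0 :
  I a0 -> (forall n a, I a -> exists2 b, I b & R n a b) ->
  exists f : nat -> A, f 0 = a0 /\ forall n, I (f n) /\ R n (f n) (f n.+1).
Proof.
move=> Ia0 step.
have /choice[g gP] (na : nat * A) : exists b, I na.2 -> I b /\ R na.1 na.2 b.
  have [Ia|nIa] := pselect (I na.2); last by exists a0.
  by have [b] := step na.1 _ Ia; exists b.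
pose f := fix f n := if n is m.+1 then g (m, f m) else a0.
have fI n : I (f n) by elim: n => //= n IHn; have [] := gP (n, f n) IHn.
by exists f; split=> // n; split=> //; have [] := gP (n, f n) (fI n).
Qed.

(** The values lie in [option A] so that empty and finite sets are enumerated too. *)
Lemma countable_enum (A : Type) (S : set A) : countable S ->
  exists e : nat -> option A, forall a, S a <-> exists n, e n = Some a.
Proof.
move=> /countable_injP[f finj].
have /choice[e eP] n : exists o : option A,
    forall a, o = Some a <-> S a /\ f a = n.
  have [[a [Sa <-]]|nS] := pselect (exists a, S a /\ f a = n).
    exists (Some a) => b; split=> [[<-]//|[Sb fba]].
    by rewrite (finj a b) ?inE.
  by exists None => a; split=> // San; case: nS; exists a.
exists e => a; split=> [Sa|[n /eP[]//]].
by exists (f a); apply/eP.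
Qed.

(** * Ranks in a tree, as a substitute for ordinal levels *)

Section Rank.
Context {d : Order.disp_t} {P : porderType d} (T : set P).

(* The level of [s] is at most the level of [t], by comparison of the
   well-founded ranks for [>]: this avoids speaking of ordinals. *)
Inductive rank_le : P -> P -> Prop :=
  RankLe s t of (forall s', T s' -> s < s' ->
    exists2 t', T t' /\ t < t' & rank_le s' t') : rank_le s t.

Definition same_rank s t := rank_le s t /\ rank_le t s.

Lemma rank_leE s t : rank_le s t <-> forall s', T s' -> s < s' ->
  exists2 t', T t' /\ t < t' & rank_le s' t'.
Proof. by split=> [[]|]. Qed.

Hypothesis treeT : is_tree T.

Lemma tree_pred_total t x y : T t -> tree_pred T t x -> tree_pred T t y ->
  x <= y \/ y <= x.
Proof.
move=> Tt tx ty; have /wo_chainW wo := treeT.2 t Tt.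
by have /orP[] := wo x y (mem_set tx) (mem_set ty); [right|left].
Qed.

Lemma tree_above_total t x y : T t -> T x -> T y -> t <= x -> t <= y ->
  x <= y \/ y <= x.
Proof.
move=> Tt Tx Ty; rewrite le_eqVlt => /predU1P[<-|tx]; first by left.
rewrite le_eqVlt => /predU1P[<-|ty]; first by right; apply: ltW.
exact: (tree_pred_total Tt).
Qed.

(** If some [t] in [A] is not maximal, the elements of [A] above [t] are predecessors of [t], and
    their least element for the reverse order is maximal in [A]. *)
Lemma tree_has_maximal (A : set P) : A `<=` T -> A !=set0 ->
  exists2 m, A m & forall a, A a -> ~ m < a.
Proof.
move=> AT [t At].
have [[a [Aa ta]]|nA] := pselect (exists a, A a /\ t < a); last first.
  by exists t => // a Aa ta; apply: nA; exists a.
pose B := [set a | A a /\ t < a].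
have sBt : sub_mem (mem B) (mem (tree_pred T t)).
  by move=> x /set_mem[Ax tx]; apply/mem_set; split=> //; apply: AT.
have neB : nonempty (mem B) by exists a; apply/mem_set.
have [z [[/set_mem[Az tz] ub] _]] := treeT.2 t (AT _ At) (mem B) sBt neB.
exists z => // b Ab zb.
have bB : b \in mem B by apply/mem_set; split=> //; apply: lt_trans zb.
by have := le_lt_trans (ub b bB : b <= z) zb; rewrite ltxx.
Qed.

Lemma tree_ind (A : P -> Prop) :
  (forall t, T t -> (forall s, T s -> t < s -> A s) -> A t) ->
  forall t, T t -> A t.
Proof.
move=> IH t Tt; apply: contrapT => nAt.
have [x [Tx nAx] mx] := @tree_has_maximal [set x | T x /\ ~ A x]
  (fun x h => h.1) (ex_intro _ t (conj Tt nAt)).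
apply: nAx; apply: IH => // s Ts xs; apply: contrapT => nAs.
exact: (mx s).
Qed.

Lemma rank_le_refl t : T t -> rank_le t t.
Proof.
move: t; apply: tree_ind => t Tt IH; apply/rank_leE => s Ts ts.
by exists s => //; apply: IH.
Qed.

Lemma rank_le_trans s t u : T s -> rank_le s t -> rank_le t u -> rank_le s u.
Proof.
move=> Ts; move: s Ts t u; apply: tree_ind => s Ts IH t u st tu.
apply/rank_leE => s' Ts' ss'.
have [t' [Tt' tt'] s't'] := (rank_leE s t).1 st _ Ts' ss'.
have [u' [Tu' uu'] t'u'] := (rank_leE t u).1 tu _ Tt' tt'.
by exists u' => //; apply: IH t'u'.
Qed.

Lemma rank_le_total s t : T s ->
  rank_le s t \/ exists2 s', T s' /\ s < s' & rank_le t s'.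
Proof.
move=> Ts; move: s Ts t; apply: tree_ind => s Ts IH t.
have [st|/rank_leE nst] := pselect (rank_le s t); first by left.
right; move/existsNP: nst => [s' /not_implyP[Ts' /not_implyP[ss' nt]]].
exists s' => //; apply/rank_leE => t' Tt' tt'.
by have [s't'|//] := IH s' Ts' ss' t'; case: nt; exists t'.
Qed.

Lemma lt_rank_le s t : T t -> s < t -> rank_le t s.
Proof.
move=> Tt st; apply/rank_leE => t' Tt' tt'.
by exists t'; [split=> //; apply: lt_trans tt'|apply: rank_le_refl].
Qed.

Lemma le_rank_le s t : T t -> s <= t -> rank_le t s.
Proof.
move=> Tt; rewrite le_eqVlt => /predU1P[->|]; first exact: rank_le_refl.
exact: lt_rank_le.
Qed.

Lemma lt_rank_leF s t : T t -> s < t -> ~ rank_le s t.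
Proof.
move=> Tt; move: t Tt s; apply: tree_ind => t Tt IH s st /rank_leE.
by move=> /(_ t Tt st)[t' [Tt' tt']]; apply: IH.
Qed.

(** Induction from the top on a bound [s] for the rank of some member of [A]: if no element above
    [s] is such a bound, then by totality a member bounded by [s] has least rank. *)
Lemma rank_has_min (A : set P) : A `<=` T -> A !=set0 ->
  exists2 m, A m & forall a, A a -> rank_le m a.
Proof.
move=> AT [a Aa].
suff: forall s, T s -> forall a, A a -> rank_le a s ->
    exists2 m, A m & forall a, A a -> rank_le m a.
  by move=> /(_ a (AT _ Aa) a Aa); apply; apply: rank_le_refl; apply: AT.
apply: tree_ind => s Ts IH b Ab bs.
have [[s' [Ts' ss' [c [Ac cs']]]]|nA] := pselect (exists s', [/\ T s', s < s' &
    exists c, A c /\ rank_le c s']); first exact: IH Ac cs'.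
exists b => // c Ac; apply: (rank_le_trans (AT _ Ab) bs).
have [//|[s' [Ts' ss'] cs']] := rank_le_total c Ts.
by case: nA; exists s'; split=> //; exists c.
Qed.

(** The largest [u] above [w] whose rank is still at least that of [v] works: every element strictly
    above [u] has rank strictly less than that of [v]. *)
Lemma same_rank_above v w : T v -> T w -> rank_le v w ->
  exists u, [/\ T u, w <= u & same_rank u v].
Proof.
move=> Tv Tw vw.
have [u [Tu wu vu] mu] := @tree_has_maximal
  [set u | [/\ T u, w <= u & rank_le v u]] (fun x h => let: And3 h _ _ := h in h)
  (ex_intro _ w (And3 Tw (lexx w) vw)).
exists u; split=> //; split=> //; apply/rank_leE => u' Tu' uu'.
have [vu'|//] := rank_le_total u' Tv.
by case: (mu u') => //; split=> //; apply: le_trans (ltW uu').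
Qed.

Lemma le_rank t x y : T t -> tree_pred T t x -> tree_pred T t y ->
  rank_le x y -> y <= x.
Proof.
move=> Tt tx ty xy; have [|//] := tree_pred_total Tt tx ty.
rewrite le_eqVlt => /predU1P[->//|ltxy].
by case: (lt_rank_leF ty.1 ltxy).
Qed.

Lemma le_same_rank t u x y x' y' : T t -> T u ->
  tree_pred T t x -> tree_pred T t y -> tree_pred T u x' -> tree_pred T u y' ->
  same_rank x' x -> same_rank y' y -> x <= y -> x' <= y'.
Proof.
move=> Tt Tu tx ty ux' uy' [xx' x'x] [yy' y'y] xy.
apply: (le_rank Tu uy' ux'); apply: (rank_le_trans uy'.1 yy').
by apply: rank_le_trans x'x; [exact: ty.1|apply: le_rank_le => //; exact: ty.1].
Qed.

End Rank.

(** * The predecessors of a tree element as a well-ordered type *)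

Section PredType.
Context {d : Order.disp_t} {P : porderType d} (T : set P) (treeT : is_tree T).
Context (t : P) (Tt : T t).

(* The two proofs are phantom arguments that the instances below rely on. *)
Definition pred_type of is_tree T & T t := {x : P | x \in tree_pred T t}.
Local Notation alpha := (pred_type treeT Tt).

HB.instance Definition _ := Choice.on alpha.

Definition pred_type_le (x y : alpha) : bool := val y <= val x.

Lemma pred_type_le_refl : reflexive pred_type_le.
Proof. by move=> x; apply: lexx. Qed.

Lemma pred_type_le_anti : antisymmetric pred_type_le.
Proof. by move=> x y /le_anti yx; apply: val_inj. Qed.

Lemma pred_type_le_trans : transitive pred_type_le.
Proof. by move=> y x z xy yz; apply: le_trans xy. Qed.

HB.instance Definition _ := Order.Le_isPOrder.Build d alpha
  pred_type_le_refl pred_type_le_anti pred_type_le_trans.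

Lemma pred_type_le_total : total (<=%O : rel alpha).
Proof.
move=> x y; apply/orP.
by have [] := tree_pred_total treeT Tt (set_mem (valP x)) (set_mem (valP y));
  [right|left].
Qed.

HB.instance Definition _ := Order.POrder_isTotal.Build d alpha pred_type_le_total.

Lemma pred_type_well_order : well_order (<=%O : rel alpha).
Proof.
apply: antisymmetric_well_order; first exact: le_anti.
move=> A [a Aa].
have sT : [set val x | x in [set x | x \in A]] `<=` T.
  by move=> _ [x _ <-]; have [] := set_mem (valP x).
have [|_ [x Ax <-] mx] := tree_has_maximal treeT sT; first by exists (val a), a.
exists x; split=> // y Ay.
have [//|yx] := orP (pred_type_le_total x y).
have [->|xy] := eqVneq x y; first exact: lexx.
case: (mx (val y)); first by exists y.
by rewrite lt_neqAle [_ <= _]yx andbT; apply: contraNneq xy => /val_inj->.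
Qed.

End PredType.

(** * Trees with countable levels, and why they are not dense *)

Section CountableLevels.
Context {d : Order.disp_t} {P : porderType d} (T : set P).
Hypotheses (treeT : is_tree T) (ctblT : countable_levels T).

Lemma same_rank_pred t u x : T t -> T u -> same_rank T u t -> tree_pred T t x ->
  exists2 y, tree_pred T u y & same_rank T y x.
Proof.
move=> Tt Tu [_ tu] [Tx tx].
have [y [Ty uy] xy] := (rank_leE T t u).1 tu x Tx tx.
have [z [Tz yz zx]] := same_rank_above treeT Tx Ty xy.
by exists z => //; split=> //; apply: lt_le_trans yz.
Qed.

Lemma same_rank_sym s t : same_rank T s t -> same_rank T t s.
Proof. by case. Qed.

(** Sending each predecessor of [t] to the predecessor of [u] of the same rank is an order
    isomorphism. This is the link from ranks back to levels given by order types. *)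
Lemma same_rank_level t (Tt : T t) u : T u -> same_rank T u t ->
  tree_level T (pred_type treeT Tt) u.
Proof.
move=> Tu ut; split=> //.
have /choice[f fP] (x : pred_type treeT Tt) :
    exists y, tree_pred T u y /\ same_rank T y (val x).
  by have [y] := same_rank_pred Tt Tu ut (set_mem (valP x)); exists y.
have valt (x : pred_type treeT Tt) : tree_pred T t (val x) := set_mem (valP x).
exists f.
  move=> x y; apply/idP/idP => [fyx|xy].
    apply: (le_same_rank treeT Tu Tt _ _ (valt x) (valt y) _ _ fyx);
    by [exact: (fP _).1|apply: same_rank_sym; exact: (fP _).2].
  by apply: (le_same_rank treeT Tt Tu (valt _) (valt _) _ _ _ _ xy);
    [exact: (fP _).1|exact: (fP _).1|exact: (fP _).2|exact: (fP _).2].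
apply/seteqP; split=> [_ [x _ <-]|y uy]; first exact: (fP x).1.
have [x tx xy] := same_rank_pred Tu Tt (same_rank_sym ut) uy.
exists (exist _ x (mem_set tx)) => //; set x' := exist _ _ _.
have [ux' [x'x xx']] := fP x'.
have x'y : same_rank T (f x') y.
  split; first exact: rank_le_trans ux'.1 x'x xy.1.
  exact: rank_le_trans uy.1 xy.2 xx'.
by apply/le_anti/andP; split; apply: (le_rank treeT Tu) => //; case: x'y.
Qed.

Lemma countable_same_rank t : T t -> countable [set u | T u /\ same_rank T u t].
Proof.
move=> Tt; have := ctblT (@pred_type_well_order _ _ _ treeT _ Tt).
apply: sub_countable.
by apply: subset_card_le => u [Tu]; apply: same_rank_level.
Qed.

Lemma no_dense_subtree (Q : set P) : Q !=set0 ->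
  (forall X : nat -> P, (forall n, Q (X n)) -> (forall n, X n.+1 <= X n) ->
    exists2 Y, Q Y & forall n, Y <= X n) ->
  (forall X, Q X -> exists Y Z, [/\ Q Y, Q Z, Y <= X, Z <= X &
    forall W, Q W -> W <= Y -> ~ W <= Z]) ->
  (forall X, Q X -> exists t, [/\ T t, Q t & t <= X]) -> False.
Proof.
move=> [q0 Qq0] Qclosed Qsplit Qdense.
(* [p] is chosen so that the supremum of the ranks of the elements of [T] below
   it is not lowered by shrinking [p] inside [Q]. *)
have [p Qp pP] : exists2 p, Q p & forall q v, Q q -> q <= p ->
    T v -> Q v -> v <= p -> exists w, [/\ T w, Q w, w <= q & rank_le T v w].
  pose A := [set v | T v /\ exists2 p, Q p & forall w, T w -> Q w -> w <= p ->
    ~ rank_le T v w].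
  have [neA|] := pselect (A !=set0); last first.
    move=> nA; exists q0 => // q v Qq qq0 Tv Qv vq0; apply: contrapT => nw.
    apply: nA; exists v; split=> //; exists q => // w Tw Qw wq vw.
    by apply: nw; exists w.
  have AT : A `<=` T by move=> v [].
  have [v0 [Tv0 [p Qp pv0]] minv0] := rank_has_min treeT AT neA.
  exists p => // q v Qq qp Tv Qv vp; apply: contrapT => nw.
  apply: (pv0 v) => //; apply: minv0; split=> //; exists q => // w Tw Qw wq vw.
  by apply: nw; exists w.
pose D := [set t | [/\ T t, Q t & t <= p]].
(* A member of [T] below both [y] and [z] would make them comparable, and the smaller would lie
   below both of the incompatible [Y] and [Z]. *)
have Dsplit t : D t -> exists yz : P * P, [/\ D yz.1, D yz.2, yz.1 <= t,
    yz.2 <= t & forall u, T u -> u <= yz.1 -> ~ u <= yz.2].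
  move=> [Tt Qt tp]; have [Y [Z [QY QZ Yt Zt YZ]]] := Qsplit t Qt.
  have [y [Ty Qy yY]] := Qdense Y QY; have [z [Tz Qz zZ]] := Qdense Z QZ.
  have yt := le_trans yY Yt; have zt := le_trans zZ Zt.
  exists (y, z); split=> //; [by split=> //; apply: le_trans tp..|].
  move=> u Tu uy uz; have [yz|zy] := tree_above_total treeT Tu Ty Tz uy uz.
    by apply: (YZ y) => //; apply: le_trans zZ.
  by apply: (YZ z) => //; apply: le_trans yY.
have /choice[g gP] t : exists yz : P * P, D t -> [/\ D yz.1, D yz.2, yz.1 <= t,
    yz.2 <= t & forall u, T u -> u <= yz.1 -> ~ u <= yz.2].
  by have [/Dsplit[yz]|nDt] := pselect (D t); [exists yz|exists (t, t)].
have [r Tr [Qr rp]] : exists2 t, T t & Q t /\ t <= p.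
  by have [t []] := Qdense p Qp; exists t.
have Dr : D r by [].
pose child t (b : bool) := if b then (g t).1 else (g t).2.
(* The head of the list is the last step down, so consing moves to a child. *)
pose node := foldr (fun b t => child t b) r.
have Dnode s : D (node s).
  by elim: s => //= b s /gP[]; rewrite /child; case: b.
have [v [Tv Qv vp nodev]] : exists v, [/\ T v, Q v, v <= p &
    forall s, rank_le T (node s) v].
  (* Step [n] goes down to an element of rank at least that of the node coded by [n]. An element of
     [T] below the whole sequence then bounds the ranks of all nodes. *)
  have [|f [f0 fP]] := @dependent_choice_inv _ D
      (fun n w w' => w' <= w /\ forall s, unpickle n = Some s ->
        rank_le T (node s) w') r Dr.
    move=> n w [Tw Qw wp].
    have [[s ns]|/forallNP ns] :=
        pselect (exists s : seq bool, unpickle n = Some s);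
      last by exists w => //; split=> // s /ns.
    have [Ts Qs sp] := Dnode s.
    have [w' [Tw' Qw' w'w sw']] := pP w (node s) Qw wp Ts Qs sp.
    exists w'; first by split=> //; apply: le_trans wp.
    by split=> // s'; rewrite ns => -[<-].
  have [||q Qq qf] := Qclosed f.
  - by move=> n; case: (fP n) => -[].
  - by move=> n; case: (fP n) => _ [].
  have [v [Tv Qv vq]] := Qdense q Qq; exists v; split=> //.
    by rewrite (le_trans vq)// (le_trans (qf 0%N))// f0.
  move=> s; have [_ [_ /(_ s (pickleK s)) sf]] := fP (pickle s).
  apply: (rank_le_trans treeT _ sf); first by case: (Dnode s).
  have [[Tf _ _] _] := fP (pickle s).+1.
  by apply: le_rank_le => //; apply: le_trans vq (qf _).
(* The branch [path] leaves the [n]-th element of the level of [v] at step [n]. *)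
have [e eP] := countable_enum (countable_same_rank Tv).
pose path := fix path n := if n is m.+1 then
  (if e m is Some u then ~~ (u <= child (node (path m)) true) else true) :: path m
  else [::].
have pathP n u : T u -> e n = Some u -> ~ u <= node (path n.+1).
  move=> Tu /= ->; have [_ _ _ _ gu] := gP _ (Dnode (path n)).
  by case: (boolP (u <= (g _).1)) => [/(gu u Tu)|/negP].
have [||q Qq qn] := Qclosed (node \o path).
- by move=> n; case: (Dnode (path n)).
- move=> n /=; have [_ _ g1 g2 _] := gP _ (Dnode (path n)).
  suff lec b : child (node (path n)) b <= node (path n) by apply: lec.
  by case: b.
have qp : q <= p by apply: le_trans (qn 0%N) rp.
have [w [Tw Qw wq vw]] := pP q v Qq qp Tv Qv vp.
have [u [Tu wu uv]] := same_rank_above treeT Tv Tw vw.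
(* Both [u] and the node lie above [w], so they are comparable. Were [u] strictly above, its rank
   would be less than that of the node, hence less than that of [v]. *)
have un n : u <= node (path n).
  have [Tn _ _] := Dnode (path n).
  have [//|] := tree_above_total treeT Tw Tu Tn wu (le_trans wq (qn n)).
  rewrite le_eqVlt => /predU1P[->//|nu].
  by case: (lt_rank_leF treeT Tu nu); apply: rank_le_trans uv.2.
have [n en] := (eP u).1 (conj Tu uv).
exact: pathP en (un _).
Qed.

End CountableLevels.

(** * Fusion of sequences decreasing modulo finite sets *)

Lemma infinite_nat_unbounded (A : set nat) m : infinite_set A ->
  exists2 x, A x & (m <= x)%N.
Proof.
move=> infA; apply: contrapT => nA; apply: infA.
apply: sub_finite_set (finite_II m) => x Ax /=.
by rewrite ltnNge; apply/negP => mx; apply: nA; exists x.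
Qed.

Lemma fusion_nat (A B : nat -> set nat) :
  (forall n, finite_set (A n.+1 `\` A n)) ->
  (forall n j, infinite_set (A n `\` B j)) ->
  exists Y : bool -> set nat, [/\ forall b n, finite_set (Y b `\` A n),
    forall b j, infinite_set (Y b `\` B j) & Y true `&` Y false = set0].
Proof.
move=> Adec AB.
(* The finite intersections decrease genuinely and differ from the [A n] by finite sets only. *)
pose A' n := [set x | forall i, (i <= n)%N -> A i x].
have finA' n : finite_set (A n `\` A' n).
  elim: n => [|n IHn].
    apply: sub_finite_set (finite_set0 _) => x [Ax []] i.
    by rewrite leqn0 => /eqP->.
  apply: (@sub_finite_set _ _ ((A n.+1 `\` A n) `|` (A n `\` A' n))).
    move=> x [Ax nA'x]; have [Anx|] := pselect (A n x); last by left.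
    right; split=> // A'x; apply: nA'x => i; rewrite leq_eqVlt => /predU1P[->//|].
    exact: A'x.
  by rewrite finite_setU.
have infA' n j : infinite_set (A' n `\` B j).
  move=> fin; apply: (AB n j).
  apply: (@sub_finite_set _ _ ((A' n `\` B j) `|` (A n `\` A' n))).
    by move=> x [Ax nBx]; have [|] := pselect (A' n x); [left|right].
  by rewrite finite_setU.
have /choice[h hP] (njm : nat * nat * nat) : exists x,
    [/\ A' njm.1.1 x, ~ B njm.1.2 x & (njm.2 <= x)%N].
  have [x []] := infinite_nat_unbounded njm.2 (@infA' njm.1.1 njm.1.2).
  by exists x.
(* [code n] is a triple whose last entry is a dummy, so that each pair of a side [b] and an index
   [j] is treated infinitely often. On numbers that code no triple the default merely adds harmless
   points to the side [true]. *)
pose code n : bool * nat * nat := odflt (true, 0, 0)%N (unpickle n).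
(* The lower bound [(y m).+1] makes [y] strictly increasing; injectivity then makes the two sides
   disjoint. *)
pose y := fix y n := h (n, (code n).1.2, if n is m.+1 then (y m).+1 else 0)%N.
have yP n : A' n (y n) /\ ~ B (code n).1.2 (y n).
  by case: n => [|n]; [case: (hP (0, (code 0).1.2, 0)%N)|
                       case: (hP (n.+1, (code n.+1).1.2, (y n).+1)%N)].
have ylt n : (y n < y n.+1)%N.
  by case: (hP (n.+1, (code n.+1).1.2, (y n).+1)%N).
have yinj : injective y.
  apply: incn_inj; apply: leq_mono; apply: homo_ltn ylt => k i j.
  exact: ltn_trans.
exists (fun b => y @` [set n | (code n).1.1 = b]); split.
- move=> b n; apply: sub_finite_set (finite_image y (finite_II n)).
  move=> _ [[k _ <-] nAk]; exists k => //=; rewrite ltnNge; apply/negP => nk.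
  by apply: nAk; apply: (yP k).1.
- move=> b j fin; apply: infinite_nat.
  pose f (m : nat) := y (pickle (b, j, m)).
  have finj : injective f by move=> m m' /yinj /(pcan_inj pickleK) [].
  apply: sub_finite_set (finite_preimage (in2W finj) fin) => m _.
  have codem : code (pickle (b, j, m)) = (b, j, m) by rewrite /code pickleK.
  split; first by exists (pickle (b, j, m)) => //=; rewrite codem.
  by have [_] := yP (pickle (b, j, m)); rewrite codem.
- apply/seteqP; split=> // _ [[k kb <-] [k' k'b /yinj kk']].
  by move: k'b kb; rewrite kk' /= => ->.
Qed.

(** * Fusion and complements in the quotient, and what maximality gives *)

Definition rep (X : Pfin) : set nat := val (repr X).

Lemma rep_infinite X : infinite_set (rep X).
Proof. exact/asboolP/(valP (repr X)). Qed.

Lemma Pfin_leP (X Y : Pfin) : reflect (finite_set (rep X `\` rep Y)) (X <= Y).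
Proof. exact: asboolP. Qed.

Lemma Pfin_of_infinite (A : set nat) : infinite_set A -> exists X : Pfin,
  finite_set (A `\` rep X) /\ finite_set (rep X `\` A).
Proof.
move=> infA; pose A' : infset := Sub A (asboolT infA).
exists (\pi_Pfin A')%qT.
have := repr_eqfin A'; rewrite eqfinE => /andP[/asboolP ? /asboolP ?].
by split.
Qed.

Lemma finite_setD_trans (T : Type) (A B C : set T) :
  finite_set (A `\` B) -> finite_set (B `\` C) -> finite_set (A `\` C).
Proof.
move=> AB BC; apply: (@sub_finite_set _ _ ((A `\` B) `|` (B `\` C))).
  by move=> x [Ax nCx]; have [Bx|] := pselect (B x); [right|left].
by rewrite finite_setU.
Qed.

(** A decreasing sequence gives sigma-closure, a constant one gives splitting, in both cases while
    staying below no element of [S]. *)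
Lemma Pfin_fusion (S : set Pfin) (X : nat -> Pfin) : countable S ->
  (forall n, X n.+1 <= X n) -> (forall n s, S s -> ~ X n <= s) ->
  exists Y : bool -> Pfin, [/\ forall b n, Y b <= X n,
    forall b s, S s -> ~ Y b <= s & forall W, W <= Y true -> ~ W <= Y false].
Proof.
move=> /countable_enum[e eP] Xdec XS.
(* Indices are shifted by one: [B 0] is empty, which forces both [Y b] to be infinite even if [S] is
   empty. *)
pose B j :=
  if j isn't j'.+1 then set0 else if e j' is Some s then rep s else set0.
have XB n j : infinite_set (rep (X n) `\` B j).
  case: j => [|j] /=; first by rewrite setD0; apply: rep_infinite.
  case ej: (e j) => [s|]; last by rewrite setD0; apply: rep_infinite.
  by move=> /Pfin_leP; apply: XS; apply/eP; exists j.
have [Y [YX YB Y0]] := fusion_nat (fun n => elimT (Pfin_leP _ _) (Xdec n)) XB.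
have /choice[Z ZP] b : exists Z,
    finite_set (Y b `\` rep Z) /\ finite_set (rep Z `\` Y b).
  by apply: Pfin_of_infinite => finY; apply: (YB b 0%N); rewrite setD0.
exists Z; split.
- move=> b n; apply/Pfin_leP; apply: finite_setD_trans (YX b n).
  exact: (ZP b).2.
- move=> b s /eP[j ej] /Pfin_leP Zs; apply: (YB b j.+1); rewrite /= ej.
  exact: finite_setD_trans (ZP b).1 Zs.
- move=> W /Pfin_leP WT /Pfin_leP WF; apply: (@rep_infinite W).
  have {}WT := finite_setD_trans WT (ZP true).2.
  have {}WF := finite_setD_trans WF (ZP false).2.
  apply: (@sub_finite_set _ _ ((rep W `\` Y true) `|` (rep W `\` Y false))).
    move=> x Wx; have [Tx|] := pselect (Y true x); last by left.
    right; split=> // Fx; suff: set0 x by [].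
    by rewrite -Y0.
  by rewrite finite_setU.
Qed.

(** [U] is the class of the union of [X] with the difference of [Y] and [s]: inside [s] it adds
    nothing to [X], and it is below [s] only if that difference is finite. *)
Lemma Pfin_relative_complement (X Y s : Pfin) : X <= Y ->
  exists U, [/\ X <= U, U <= Y, forall t, t <= U -> t <= s -> t <= X &
    U <= s -> Y <= s].
Proof.
move=> /Pfin_leP XY.
have [|U [UV VU]] := @Pfin_of_infinite (rep X `|` (rep Y `\` rep s)).
  by rewrite finite_setU => -[/rep_infinite].
exists U; split.
- apply/Pfin_leP; apply: sub_finite_set UV => x [Xx nUx].
  by split=> //; left.
- apply/Pfin_leP; apply: finite_setD_trans VU _; rewrite setDUl finite_setU.
  split=> //; apply: sub_finite_set (finite_set0 _) => x [[]]//.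
- move=> t /Pfin_leP tU /Pfin_leP ts; apply/Pfin_leP.
  apply: (@sub_finite_set _ _
    ((rep t `\` (rep X `|` (rep Y `\` rep s))) `|` (rep t `\` rep s))).
    move=> x [tx nXx]; have [sx|] := pselect (rep s x); last by right.
    by left; split=> // -[|[]].
  by rewrite finite_setU; split=> //; apply: finite_setD_trans tU VU.
- move=> /Pfin_leP Us; apply/Pfin_leP.
  apply: sub_finite_set (finite_setD_trans UV Us) => x [Yx nsx].
  by split=> //; right.
Qed.

(** Otherwise adding [X] to [T] gives a proper end-extension: [X] is above no element of [T], so old
    predecessor sets do not change, and the elements of [T] above [X] form a chain. *)
Lemma maximal_treeP (d : Order.disp_t) (P : tPOrderType d) (T : set P) X :
  maximal_tree T -> (exists2 t, T t & t <= X) \/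
  exists s t, [/\ T s, T t, X <= s, X <= t & ~ (s <= t \/ t <= s)].
Proof.
move=> [[T1 treeT] maxT]; apply: contrapT.
move=> /not_orP[/forall2NP noT /forallNP nochain].
have predT t : T t -> tree_pred (T `|` [set X]) t = tree_pred T t.
  move=> Tt; apply/seteqP; split=> s [Ts ts]; split=> //; last by left.
  case: Ts => // sX; have [] := noT t => //; case.
  by rewrite -[X]sX ltW.
have predX : tree_pred (T `|` [set X]) X = [set s | T s /\ X < s].
  apply/seteqP; split=> s [Ts Xs]; split=> //; last by left.
  by case: Ts => // sX; move: Xs; rewrite sX ltxx.
apply: maxT; exists (T `|` [set X]); split.
- split; first by left.
  split; first by exists \top => [|t _]; [left|apply: lex1].
  move=> t [Tt|->]; first by rewrite predT //; apply: treeT.2.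
  rewrite predX; apply: antisymmetric_wo_chain.
    by move=> x y _ _ /andP[xy yx]; apply/le_anti/andP.
  move=> A AX [a Aa].
  have AT : [set x | x \in A] `<=` T by move=> x /AX/set_mem[].
  have [|m Am mm] := tree_has_maximal treeT AT; first by exists a.
  exists m; split=> // x Ax.
  have /set_mem[Tx Xx] := AX _ Ax; have /set_mem[Tm Xm] := AX _ Am.
  have [mx|//] : m <= x \/ x <= m.
    apply: contrapT => mx; apply: (nochain m); exists x.
    by split=> //; apply: ltW.
  have [->|neq] := eqVneq x m; first exact: lexx.
  by case: (mm x Ax); rewrite lt_neqAle eq_sym neq.
- by split=> [t Tt|t Tt]; [left|apply: predT].
- by move=> TX; have [] := noT X => //; rewrite -TX => -[]; right.
Qed.

Theorem theorem2 :
  ~ exists T : set Pfin, maximal_tree T /\ countable_levels T.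
Proof.
move=> [T [maxT ctblT]]; have [[T1 treeT] _] := maxT.
pose L := [set s | [/\ T s, s != \top & forall u, T u -> s < u -> u = \top]].
have below_L t : T t -> t != \top -> exists2 s, L s & t <= s.
  move=> Tt t1.
  have [||s [Ts s1 ts] ms] := tree_has_maximal treeT
    (A := [set s | [/\ T s, s != \top & t <= s]]).
  - by move=> s [].
  - by exists t.
  exists s => //; split=> // u Tu su; apply/eqP/negPn/negP => u1.
  by apply: (ms u _ su); split=> //; apply: le_trans ts (ltW su).
have L_eq s s' : L s -> L s' -> s <= s' -> s = s'.
  move=> [_ _ s1] [Ts' s'1 _]; rewrite le_eqVlt => /predU1P[//|/(s1 _ Ts')].
  by move=> s'T; rewrite s'T eqxx in s'1.
have ctblL : countable L.
  have [[s Ls]|/forallNP nL] := pselect (exists s, L s); last first.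
    by rewrite (_ : L = set0)//; apply/seteqP; split=> // s /nL.
  have rank_L s1 s2 : L s1 -> L s2 -> rank_le T s1 s2.
    move=> [_ _ L1] [_ s21 _]; apply/rank_leE => u Tu /(L1 _ Tu)->.
    exists \top; last exact: rank_le_refl.
    by split=> //; rewrite lt_neqAle s21 lex1.
  have [Ts _ _] := Ls.
  have := countable_same_rank treeT ctblT Ts; apply: sub_countable.
  apply: subset_card_le => u Lu; have [Tu _ _] := Lu.
  by split=> //; split; apply: rank_L.
pose Q0 X := forall s, L s -> ~ X <= s.
have dense0 X : Q0 X -> exists t s, [/\ T t, t <= X, L s & t <= s].
  move=> QX.
  have [Y [YX YL Ydisj]] := Pfin_fusion ctblL (fun=> lexx X) (fun=> QX).
  have [[t Tt tY]|[s [s' [Ts Ts' Ys Ys' ss']]]] := maximal_treeP (Y true) maxT.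
    have t1 : t != \top.
      apply/eqP => t1; apply: (Ydisj (Y false)) => //.
      by apply: le_trans tY; rewrite t1 lex1.
    have [s Ls ts] := below_L t Tt t1; exists t, s; split=> //.
    exact: le_trans (YX true 0%N).
  (* Of two incomparable elements neither is the top, so [s] lies below a member of [L], which
     [Y true] must avoid. *)
  have s1 : s != \top by apply/eqP => s1; apply: ss'; right; rewrite s1 lex1.
  have [u Lu su] := below_L s Ts s1.
  by case: (YL true u Lu); apply: le_trans su.
have [s0 [X0 [Ls0 QX0 dense1]]] : exists s0 X0, [/\ L s0, Q0 X0 &
    forall X, X <= X0 -> Q0 X -> exists t, [/\ T t, t <= X & t <= s0]].
  apply: contrapT => nX0; have [e eP] := countable_enum ctblL.
  have Q0T : Q0 \top by move=> s [_ s1 _]; rewrite le1x; apply/negP.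
  (* If the claim fails, step [n] shrinks the condition until no element of [T] below it is below
     the [n]-th member of [L]. The fusion of the sequence then contradicts [dense0]. *)
  have [|f [f0 fP]] := dependent_choice_inv (I := Q0)
    (R := fun n X X' => X' <= X /\ forall s, e n = Some s ->
      forall t, T t -> t <= X' -> ~ t <= s) Q0T.
    move=> n X QX; case en: (e n) => [s|]; last by exists X.
    apply: contrapT => nX'; apply: nX0; exists s, X; split=> //.
      by apply/eP; exists n.
    move=> X' X'X QX'; apply: contrapT => nt; apply: nX'; exists X' => //.
    by split=> // _ [<-] t Tt tX' ts; apply: nt; exists t.
  have [Y [Yf YL _]] :=
    Pfin_fusion ctblL (fun n => (fP n).2.1) (fun n => (fP n).1).
  have [t [s [Tt tY /eP[n en] ts]]] := dense0 _ (YL true).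
  by case: ((fP n).2.2 s en t Tt (le_trans tY (Yf true n.+1)) ts).
pose S := [set s | L s /\ s <> s0].
have ctblS : countable S.
  by move: ctblL; apply: sub_countable; apply: subset_card_le => s [].
pose Q := [set X | [/\ X <= X0, X <= s0 & forall s, S s -> ~ X <= s]].
have QT t : T t -> t <= X0 -> t <= s0 -> Q t.
  move=> Tt tX0 ts0; split=> // s [Ls ss0] ts; apply: ss0.
  have [Ts _ _] := Ls; have [Ts0 _ _] := Ls0.
  have [ss0|s0s] := tree_above_total treeT Tt Ts Ts0 ts ts0; first exact: L_eq.
  by apply/esym; apply: L_eq.
apply: (no_dense_subtree treeT ctblT (Q := Q)).
- by have [t [Tt tX0 ts0]] := dense1 X0 (lexx _) QX0; exists t; apply: QT.
- move=> X QX Xdec.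
  have [Y [YX YS _]] :=
    Pfin_fusion ctblS Xdec (fun n => let: And3 _ _ h := QX n in h).
  exists (Y true); last exact: YX.
  have [XX0 Xs0 _] := QX 0%N.
  by split; [exact: le_trans XX0|exact: le_trans Xs0|exact: YS].
- move=> X [XX0 Xs0 XS].
  have [Y [YX YS Ydisj]] := Pfin_fusion ctblS (fun=> lexx X) (fun=> XS).
  have QY b : Q (Y b).
    split; last exact: YS; first exact: le_trans (YX b 0%N) XX0.
    exact: le_trans (YX b 0%N) Xs0.
  exists (Y true), (Y false).
  by split; [exact: QY..|exact: (YX _ 0%N)|exact: (YX _ 0%N)|by move=> W _; apply: Ydisj].
- move=> X [XX0 Xs0 XS].
  (* [X] is below [s0], hence not in [Q0], and [dense1] does not apply to it. Enlarging it by the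
     part of [X0] outside [s0] gives a set in [Q0] with the same elements below [s0]. *)
  have [U [XU UX0 Us UX0s]] := Pfin_relative_complement s0 XX0.
  have [|t [Tt tU ts0]] := dense1 U UX0.
    move=> s Ls sU; have [ss0|ss0] := pselect (s = s0).
      by apply: (QX0 s0 Ls0); apply: UX0s; rewrite -ss0.
    by apply: (XS s) => //; apply: le_trans sU.
  exists t; split=> //; last exact: Us.
  by apply: QT => //; apply: le_trans UX0.
Qed.
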